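(* Let $\omega^*=\beta\omega\setminus\omega$. If there is a splitting chain of clopen subsets of $\omega^*$, then there is a nontrivial short exact sequence of Banach spaces $$0\longrightarrow C(\omega^* )\longrightarrow Z\longrightarrow c_0(\mathfrak c)\longrightarrow 0 .$$
   Context: $\omega^*=\beta\omega\setminus\omega$ is the remainder of the Čech–Stone compactification of the discrete space $\omega$; $\mathfrak c=2^{\aleph_0}$. For open $U,V$ in a Hausdorff space, $U<V$ means $\overline U\subseteq V$, and $U\le V$ means $U<V$ or $U=V$. A family of open sets is a chain if it is linearly ordered by $\le$ (for clopen sets this is inclusion). A set $A$ splits a set $B$ if $B\cap A\neq\varnothing$ and $B\setminus A\ne\varnothing$; a family of subsets of a space $X$ is splitting if every nonempty open subset of $X$ is split by some member of the family. A splitting chain is a chain of open sets which is splitting. $C(K)$ is the Banach space of continuous functions $K\to\mathbb R$ with the sup norm. For a set $I$, $c_0(I)$ is the space of functions $f\colon I\to\mathbb R$ such that $\{i\in I:|f(i)|>\varepsilon\}$ is finite for every $\varepsilon>0$, with the sup norm. A short exact sequence $0\to Y\xrightarrow{\imath}Z\xrightarrow{\pi}X\to0$ of Banach spaces is a diagram of Banach spaces and bounded linear operators in which the kernel of each arrow equals the range of the preceding one. It is trivial if there is a bounded linear operator $\varpi\colon Z\to Y$ with $\varpi\circ\imath=\mathrm{Id}_Y$; otherwise it is nontrivial. *)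

(* Defs.v *)
From HB Require Import structures.
From mathcomp Require Import all_boot all_order all_algebra.
From mathcomp Require Import ring lra.
From mathcomp Require Import all_classical all_reals all_analysis.

Set Implicit Arguments.
Unset Strict Implicit.
Unset Printing Implicit Defensive.

Import Order.TTheory GRing.Theory Num.Theory.
Import numFieldNormedType.Exports.

Local Open Scope classical_set_scope.
Local Open Scope ring_scope.

Section splitting_chains.
Variable X : topologicalType.
Implicit Types (U V A B : set X) (F : set (set X)).

Definition well_inside U V := closure U `<=` V.

Definition chain_le U V := well_inside U V \/ U = V.

Definition chain F :=
  (forall U, F U -> open U) /\
  (forall U V, F U -> F V -> chain_le U V \/ chain_le V U).

Definition splits A B := B `&` A !=set0 /\ B `\` A !=set0.

Definition splitting F :=
  forall U, open U -> U !=set0 -> exists2 A, F A & splits A U.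

Definition splitting_chain F := chain F /\ splitting F.

End splitting_chains.

(* The Cech-Stone compactification of a discrete space T, realized as the set
   of ultrafilters on T; the sets {F | A \in F}, for A a subset of T, form a
   base of open sets. *)
Definition beta (T : Type) := {F : set_system T | UltraFilter F}.

Section beta_topology.
Variable T : Type.

HB.instance Definition _ := gen_eqMixin (beta T).
HB.instance Definition _ := gen_choiceMixin (beta T).

Definition beta_basic (A : set T) : set (beta T) := [set F | sval F A].

Lemma beta_basic_cover : \bigcup_(A in setT) beta_basic A = setT.
Proof.
rewrite predeqE => F; split => // _; exists setT => //.
by case: F => F FU; rewrite /beta_basic /=; exact: filterT.
Qed.

Lemma beta_basic_join (A B : set T) (F : beta T) : setT A -> setT B ->
  beta_basic A F -> beta_basic B F ->
  exists C, [/\ setT C, beta_basic C F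
             & beta_basic C `<=` beta_basic A `&` beta_basic B].
Proof.
move=> _ _ FA FB; exists (A `&` B); split => //.
  by move: FA FB; rewrite /beta_basic /=; case: F => F FU /=; exact: filterI.
move=> -[G GU]; rewrite /beta_basic /= => GAB.
by split; apply: filterS GAB => x [].
Qed.

HB.instance Definition _ := isBaseTopological.Build (beta T)
  beta_basic_cover beta_basic_join.

Lemma beta_basic_open A : open (beta_basic A).
Proof. by exists [set A] => //; rewrite bigcup_set1. Qed.

Definition beta_inj (x : T) : beta T :=
  exist _ (principal_filter x) (principal_filter_ultra x).

Lemma beta_nbhs (F : beta T) (W : set (beta T)) :
  nbhs F W -> exists2 A, sval F A & beta_basic A `<=` W.
Proof.
rewrite nbhsE => -[V [[D _ <-] [A DA FA]] VW].
by exists A => // G GA; apply: VW; exists A.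
Qed.

Lemma beta_compact : compact [set: beta T].
Proof.
rewrite compact_ultra => G GU _.
have PG : ProperFilter G by exact: ultra_proper.
have PF : ProperFilter [set A : set T | G (beta_basic A)].
  apply: Build_ProperFilter_ex.
    move=> A /(@filter_ex _ _ PG) [[F FU] FA].
    exact: (@filter_ex _ _ (@ultra_proper _ _ FU) _ FA).
  split.
  - rewrite /=; apply: (@filterS _ G _ setT); last exact: filterT.
    by move=> -[F FU] _; exact: filterT.
  - move=> A B /= GA GB; apply: (@filterS _ G _ _ _ _ (filterI GA GB)).
    by move=> -[F FU] [/= FA FB]; exact: filterI.
  - by move=> A B AB /=; apply: filterS => -[F FU]; exact: filterS.
have UF : UltraFilter [set A : set T | G (beta_basic A)].
  split=> // H HF GH; rewrite eqEsubset; split=> // A HA.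
  have [//|GnA] := in_ultra_setVsetC (beta_basic A) GU.
  have : H (A `&` ~` A).
    apply: filterI => //; apply: GH.
    apply: filterS GnA => -[F FU] /= nFA.
    by have [] := in_ultra_setVsetC A FU.
  by rewrite setICr => /filter_ex[].
exists (exist _ _ UF); split=> // W /beta_nbhs[A GA AW].
by apply: (@filterS _ G _ _ _ AW); exact: GA.
Qed.

Lemma beta_inj_range_open : open (range beta_inj).
Proof.
suff -> : range beta_inj = \bigcup_x beta_basic [set x].
  by apply: bigcup_open => x _; exact: beta_basic_open.
rewrite predeqE => F; split => [[x _ <-]|[x _]].
  by exists x => //; rewrite /beta_basic /=; apply/principal_filterP.
case: F => F FU; rewrite /beta_basic /= => Fx; exists x => //.
apply: eq_exist; apply/esym.
apply: (@max_filter _ _ (principal_filter_ultra x)).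
by move=> A /principal_filterP Ax; apply: filterS Fx => y ->.
Qed.

End beta_topology.

Definition omega_star : topologicalType :=
  set_type (~` range (@beta_inj nat)).

Lemma omega_star_compact : compact [set: omega_star].
Proof.
have cA : compact (~` range (@beta_inj nat)).
  apply: subclosed_compact (@beta_compact nat) _ => //.
  by rewrite closedC; exact: beta_inj_range_open.
move=> F FF _.
have [|p [Ap Fp]] := cA (set_val @ F) _.
  rewrite /nbhs/=; apply: (@filterS _ F _ setT); last exact: filterT.
  by move=> -[x xA] _; exact: set_mem.
exists (SigSub (mem_set Ap)); split => // U V FU.
rewrite nbhsE => -[W [[W' oW' <-] /= pW'] WV].
have FU' : (set_val @ F) (set_val @` U).
  rewrite /nbhs/=; apply: (@filterS _ F _ U) FU => x Ux.
  by exists x.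
have [_ [[u Uu <-] W'u]] := Fp _ _ FU' (open_nbhs_nbhs (conj oW' pW')).
by exists u; split=> //; exact: WV.
Qed.

Section sup_spaces.
Variables (R : realType) (T : Type).

(* A linear subspace of the bounded functions T -> R that is closed under
   uniform limits; with the sup norm it is a Banach space. *)
Record sup_space := SupSpace {
  sup_space_pred : {pred T -> R};
  _ : submod_closed sup_space_pred;
  _ : forall f, f \in sup_space_pred -> exists M, forall x, `|f x| <= M;
  _ : forall f,
        (forall e, 0 < e ->
           exists2 g, g \in sup_space_pred & forall x, `|f x - g x| <= e) ->
        f \in sup_space_pred }.

Variable S : sup_space.

Lemma sup_space_submod : submod_closed (sup_space_pred S).
Proof. by case: S. Qed.

Lemma sup_space_closed (f : T -> R) :
  (forall e, 0 < e ->
     exists2 g, g \in sup_space_pred S & forall x, `|f x - g x| <= e) ->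
  f \in sup_space_pred S.
Proof. by case: S => P _ _ + /=; apply. Qed.

HB.instance Definition _ :=
  GRing.isSubmodClosed.Build R (T -> R) (sup_space_pred S) sup_space_submod.

Record sup_space_type :=
  SupSpaceElt { sup_fun :> T -> R; _ : sup_fun \in sup_space_pred S }.

HB.instance Definition _ := [isSub for sup_fun].
HB.instance Definition _ := [Choice of sup_space_type by <:].
HB.instance Definition _ :=
  [SubChoice_isSubLmodule of sup_space_type by <:].

Definition sup_norm (f : sup_space_type) : R := sup (range (fun x => `|f x|)).

Implicit Types f g : sup_space_type.

Lemma sup_fun_bounded f : exists M, forall x, `|f x| <= M.
Proof. by case: f => f Sf /=; case: S Sf => P _ + _ /=; apply. Qed.

Lemma sup_norm_ub f x : `|f x| <= sup_norm f.
Proof.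
apply: ub_le_sup; last by exists x.
by have [M fM] := sup_fun_bounded f; exists M => _ [y _ <-].
Qed.

Lemma sup_norm_le f (M : R) :
  0 <= M -> (forall x, `|f x| <= M) -> sup_norm f <= M.
Proof.
move=> M0 fM; rewrite /sup_norm; have [->|/set0P ne] := eqVneq (range (fun x => `|f x|)) set0.
  by rewrite sup0.
by apply: ge_sup => // _ [y _ <-].
Qed.

Lemma sup_norm_ge0 f : 0 <= sup_norm f.
Proof.
have [[x _]|T0] := pselect (exists x : T, True).
  exact: le_trans (sup_norm_ub f x).
rewrite /sup_norm; suff -> : range (fun x => `|f x|) = set0 by rewrite sup0.
by rewrite -subset0 => y [x _ _]; apply: T0; exists x.
Qed.

Lemma sup_normD f g : sup_norm (f + g) <= sup_norm f + sup_norm g.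
Proof.
apply: sup_norm_le => [|x]; first by rewrite addr_ge0 ?sup_norm_ge0.
by rewrite (le_trans (ler_normD _ _))// lerD ?sup_norm_ub.
Qed.

Lemma sup_normZ (a : R) f : sup_norm (a *: f) = `|a| * sup_norm f.
Proof.
have le (b : R) (h : sup_space_type) : sup_norm (b *: h) <= `|b| * sup_norm h.
  apply: sup_norm_le => [|x]; first by rewrite mulr_ge0 ?sup_norm_ge0.
  by rewrite normrM ler_wpM2l ?normr_ge0 ?sup_norm_ub.
apply/eqP; rewrite eq_le le/=; have [->|a0] := eqVneq a 0.
  by rewrite normr0 mul0r sup_norm_ge0.
rewrite -ler_pdivlMl ?normr_gt0// -normfV.
by rewrite -[in leLHS](scalerK a0 f) le.
Qed.

Lemma sup_norm_eq0 f : sup_norm f = 0 -> f = 0.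
Proof.
move=> f0; apply: val_inj; apply/funext => x; apply/eqP.
by rewrite -normr_le0 -f0 sup_norm_ub.
Qed.

HB.instance Definition _ := Lmodule_isNormed.Build R sup_space_type
  sup_normD sup_normZ sup_norm_eq0.

Lemma sup_space_complete (F : set_system sup_space_type) :
  ProperFilter F -> cauchy F -> cvg F.
Proof.
move=> FF /cauchyP Fc.
have FcR x : cvg ((fun g : sup_space_type => g x) @ F).
  apply: cauchy_cvg; apply/cauchyP => e e0.
  have [g Fg] := Fc e e0; exists (g x).
  apply: (@filterS _ F _ _ _ _ Fg) => h; rewrite -!ball_normE/=.
  exact: le_lt_trans (sup_norm_ub (g - h) x).
pose f x : R := lim ((fun g : sup_space_type => g x) @ F).
have Ff e : 0 < e ->
    exists2 g, F (ball g e) & forall x, `|f x - (g : sup_space_type) x| <= e.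
  move=> e0; have [g Fg] := Fc e e0; exists g => // x.
  apply/ler_addgt0Pl => d d0.
  have /cvgrPdist_lt/(_ d d0) Fd := FcR x.
  have [h [/= hd hg]] := filter_ex (filterI Fd Fg).
  rewrite -(subrKA (h x)) (le_trans (ler_normD _ _))// lerD ?(ltW hd)//.
  rewrite distrC; move: hg; rewrite -ball_normE/= => /ltW.
  exact: le_trans (sup_norm_ub (g - h) x).
have Sf : f \in sup_space_pred S.
  apply: sup_space_closed => e e0; have [g _ gf] := Ff e e0.
  by exists (sup_fun g) => //; case: (g).
apply/cvg_ex; exists (SupSpaceElt Sf); apply/fcvgrPdist_lt => e e0.
have e3 : 0 < e / 3 by rewrite divr_gt0.
have [g Fg gf] := Ff _ e3.
apply: (@filterS _ F _ _ _ _ Fg) => h; rewrite -ball_normE/= => gh.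
rewrite -(subrKA g) (le_lt_trans (ler_normD _ _))//.
have : `|SupSpaceElt Sf - g| <= e / 3 by apply: sup_norm_le => //; exact: ltW.
by lra.
Qed.

HB.instance Definition _ :=
  Uniform_isComplete.Build sup_space_type sup_space_complete.

End sup_spaces.

Section continuous_functions.
Context (R : realType) (K : topologicalType) (cK : compact [set: K]).

Definition continuous_pred : {pred (K -> R)} := [pred f | `[< continuous f >]].

Lemma continuous_submod : submod_closed continuous_pred.
Proof.
split=> [|a f g /asboolP cf /asboolP cg]; apply/asboolP => x.
  exact: cst_continuous.
by apply: cvgD; [apply: cvgM; [exact: cvg_cst|exact: cf]|exact: cg].
Qed.

Lemma continuous_bounded (f : K -> R) :
  f \in continuous_pred -> exists M, forall x, `|f x| <= M.
Proof.
move=> /asboolP cf.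
have /compact_bounded[M [_ fM]] : compact (f @` [set: K]).
  by apply: continuous_compact => //; exact: continuous_subspaceT.
exists (M + 1) => x; apply: fM; last by exists x.
by rewrite ltrDl.
Qed.

Lemma continuous_uniform_closed (f : K -> R) :
  (forall e, 0 < e ->
     exists2 g, g \in continuous_pred & forall x, `|f x - g x| <= e) ->
  f \in continuous_pred.
Proof.
move=> fu; apply/asboolP => x; apply/cvgrPdist_lt => e e0.
have e4 : 0 < e / 4 by rewrite divr_gt0.
have [g /asboolP cg gf] := fu _ e4.
have /cvgrPdist_lt/(_ _ e4) := cg x.
apply: filterS => y gxy.
have -> : f x - f y = (f x - g x) + (g x - g y) - (f y - g y) by ring.
have := gf x; have := gf y.
have := ler_normB ((f x - g x) + (g x - g y)) (f y - g y).
have := ler_normD (f x - g x) (g x - g y).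
by lra.
Qed.

Definition C_space : completeNormedModType R :=
  sup_space_type (SupSpace continuous_submod continuous_bounded
                           continuous_uniform_closed).

End continuous_functions.

Section c0_space.
Variables (R : realType) (I : Type).

Definition c0_pred : {pred (I -> R)} :=
  [pred f | `[< forall e : R, 0 < e -> finite_set [set i | e < `|f i|] >]].

Lemma c0_submod : submod_closed c0_pred.
Proof.
split=> [|a f g /asboolP cf /asboolP cg]; apply/asboolP => e e0.
  by apply: sub_finite_set (@finite_set0 I) => i /=; rewrite normr0; lra.
have d0 : 0 < e / 2 / (`|a| + 1).
  by rewrite !divr_gt0// ltr_wpDl.
have e2 : 0 < e / 2 by rewrite divr_gt0.
have : finite_set ([set i | e / 2 / (`|a| + 1) < `|f i|] `|`
                   [set i | e / 2 < `|g i|]).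
  by rewrite finite_setU; split; [exact: cf|exact: cg].
apply: sub_finite_set => i /= efg; apply/orP; rewrite !ltNge -negb_and.
apply/negP => /andP[fi gi]; move: efg; apply/negP; rewrite -leNgt.
rewrite (le_trans (ler_normD _ _))// normrM.
suff : `|a| * `|f i| <= e / 2 by move: gi; lra.
move: fi; rewrite ler_pdivlMr ?ltr_wpDl//; apply: le_trans.
by rewrite mulrC ler_wpM2l// lerDl.
Qed.

Lemma c0_bounded (f : I -> R) :
  f \in c0_pred -> exists M, forall i, `|f i| <= M.
Proof.
move=> /asboolP/(_ 1 ltr01) /(finite_image (fun i => `|f i|)).
move=> /finite_seqP[s sE]; exists (1 + \sum_(r <- s) `|r|) => i.
have [fi|fi] := leP `|f i| 1.
  by rewrite (le_trans fi)// lerDl sumr_ge0.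
have : `|f i| \in s.
  suff : [set` s] `|f i| by [].
  by rewrite -sE; exists i.
move=> /(big_rem _) -> /=; rewrite normr_id.
have : 0 <= \sum_(r <- rem `|f i| s) `|r| by rewrite sumr_ge0.
by lra.
Qed.

Lemma c0_uniform_closed (f : I -> R) :
  (forall e, 0 < e ->
     exists2 g, g \in c0_pred & forall i, `|f i - g i| <= e) ->
  f \in c0_pred.
Proof.
move=> fu; apply/asboolP => e e0.
have e2 : 0 < e / 2 by rewrite divr_gt0.
have [g /asboolP/(_ _ e2) + gf] := fu _ e2.
apply: sub_finite_set => i /= fi.
have := ler_normD (f i - g i) (g i); rewrite subrK.
by have := gf i; lra.
Qed.

Definition c0_space : completeNormedModType R :=
  sup_space_type (SupSpace c0_submod c0_bounded c0_uniform_closed).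

End c0_space.

Definition continuum : Type := nat -> bool.

Section short_exact_sequences.
Variable R : realType.

Definition bounded_op (V W : normedModType R) (f : V -> W) :=
  exists M : R, forall x, `|f x| <= M * `|x|.

Definition short_exact (Y Z X : completeNormedModType R)
    (i : {linear Y -> Z}) (p : {linear Z -> X}) :=
  [/\ bounded_op i, bounded_op p,
      [set y | i y = 0] = [set 0],
      [set z | p z = 0] = range i &
      range p = [set: X]].

Definition trivial_sequence (Y Z : completeNormedModType R)
    (i : {linear Y -> Z}) :=
  exists2 q : {linear Z -> Y}, bounded_op q & q \o i = id.

End short_exact_sequences.

(* Main.v *)
(** For open sets [O i] of a compact space [K], indexed by [I], let [Z] be the
    uniform closure, among bounded functions on the disjoint union of [K] and
    [I], of the span of the pairs [(h, 0)], [h] continuous, and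
    [(\1_(O i), delta_i)].  If any two distinct indices [i], [j] have a clopen
    set between [O i] and [O j], then every finite combination
    [\sum_i a_i \1_(O i)] is within [max |a_i|] of a continuous function, so
    restriction to [I] maps [Z] onto [c_0(I)] with kernel [C(K)].
    If moreover every nonempty open set contains a point adherent both to some
    [O i] and to its exterior, then a projection [q] of [Z] onto [C(K)] cannot
    be bounded: at such a point [\1_(O i)] differs from any continuous function
    by at least 1/2 on one of the two sides, and iterating inside smaller and
    smaller open sets gives [z = \sum_i +-(\1_(O i), delta_i)] with [z - q z]
    arbitrarily large, while [z] stays close to [C(K)].
    In [omega^*], for every nonempty clopen [V] the splitting chain contains an
    increasing sequence that is strictly increasing inside [V]; its union [O]
    has the two-sided property in [V], since otherwise the closure of [O] in
    [V] would be clopen, although a nonempty intersection of countably many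
    decreasing clopen sets of [omega^*] has nonempty interior.  There are
    continuum many clopen sets [V]; repeated unions are replaced by the empty
    set. *)
Require Import Defs.
From HB Require Import structures.
From mathcomp Require Import all_boot all_order all_algebra.
From mathcomp Require Import ring lra.
From mathcomp Require Import all_classical all_reals all_analysis.

Set Implicit Arguments.
Unset Strict Implicit.
Unset Printing Implicit Defensive.

Import Order.TTheory GRing.Theory Num.Theory.
Import numFieldNormedType.Exports.

Local Open Scope classical_set_scope.
Local Open Scope ring_scope.

(** * Surjectivity by successive approximation *)

(** Lift [w], then the error left over, and so on. The errors decay like [2^-n], so the series of
    lifts converges absolutely, and boundedness of [p] shows that its sum is mapped to [w]. *)
Lemma surjective_of_half_lifting (R : realType) (V W : completeNormedModType R)
    (p : {linear V -> W}) : bounded_op p ->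
  (forall w, exists2 v, `|v| <= `|w| & `|w - p v| <= `|w| / 2) ->
  range p = [set: W].
Proof.
move=> [M pM] lift; rewrite -subTset => w _.
have {lift}[phi phi1 phi2] : exists2 phi : W -> V,
    (forall w, `|phi w| <= `|w|) & forall w, `|w - p (phi w)| <= `|w| / 2.
  have /choice[phi phiP] : forall w, exists v, `|v| <= `|w| /\ `|w - p v| <= `|w| / 2.
    by move=> u; have [v ? ?] := lift u; exists v.
  by exists phi => u; have [] := phiP u.
pose e n := iter n (fun u => u - p (phi u)) w.
have e_le n : `|e n| <= geometric `|w| (2^-1) n.
  elim: n => [|n IH]; first by rewrite /geometric /= expr0 mulr1.
  apply: le_trans (phi2 _) _; rewrite /geometric /= exprSr mulrA.
  by rewrite ler_wpM2r.
have half1 : `|2^-1 : R| < 1 by rewrite ger0_norm; lra.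
pose u n := phi (e n).
have cu : cvgn (series u).
  apply: normed_cvg.
  apply: (@series_le_cvg _ _ (geometric `|w| (2^-1))) => [n|n|n|] //=.
  - exact: le_trans (phi1 _) (e_le n).
  - exact: is_cvg_geometric_series.
have ps n : w - p (series u n) = e n.
  elim: n => [|n IH]; first by rewrite /series /= big_geq // linear0 subr0.
  rewrite /series /= big_nat_recr //= linearD opprD addrA.
  by move: IH; rewrite /series /= => ->.
exists (limn (series u)) => //; apply/eqP; rewrite eq_sym -subr_eq0 -normr_le0.
apply/ler_addgt0Pl => d d0; rewrite addr0.
(* The bound [M] may be zero or negative, so one divides by [|M| + 1] instead. *)
have M1 : 0 < `|M| + 1 by rewrite ltr_wpDl.
have d1 : 0 < d / 2 / (`|M| + 1) by rewrite !divr_gt0.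
have /cvgrPdist_lt/(_ _ d1) near1 : series u @ \oo --> limn (series u) by exact: cu.
have /cvgrPdist_lt/(_ (d / 2)) near2 : geometric `|w| (2^-1) @ \oo --> 0.
  exact: cvg_geometric.
have {}near2 := near2 (divr_gt0 d0 (ltr0Sn _ _)).
have [n [/= n1 n2]] := filter_ex (filterI near1 near2).
have -> : w - p (limn (series u)) = e n - p (limn (series u) - series u n).
  by rewrite linearB -ps opprB addrA subrK.
rewrite (le_trans (ler_normB _ _))// (splitr d) lerD//.
  apply: le_trans (e_le n) _; move: n2; rewrite sub0r normrN => /ltW.
  exact/le_trans/ler_norm.
apply: le_trans (pM _) _.
move: n1; rewrite ltr_pdivlMr// mulrC => /ltW; apply: le_trans.
rewrite ler_wpM2r// (le_trans (ler_norm _))// lerDl//.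
Qed.

(** * Finite sums of indicators of clopen-separated sets *)

(** A set is in this relation to itself only if it is clopen, so comparability is demanded for
    distinct indices only. *)
Definition clopen_separated (K : topologicalType) (A B : set K) :=
  exists U, [/\ clopen U, A `<=` U & U `<=` B].

Lemma clopen_indic_continuous (R : realType) (K : topologicalType) (U : set K) :
  clopen U -> continuous (\1_U : K -> R).
Proof.
move=> [oU cU] x; have [Ux|nUx] := pselect (U x).
  apply: (@cvg_near_cst _ _ _ _ _ _); near=> y.
  by rewrite !indicE !mem_set//; near: y; exact: open_nbhs_nbhs.
apply: (@cvg_near_cst _ _ _ _ _ _); near=> y.
rewrite !indicE !memNset//; near: y; apply: open_nbhs_nbhs; split => //.
by rewrite openC.
Unshelve. all: by end_near. Qed.

(** The relation is transitive and compares any two distinct indices, so a nonempty finite list has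
    a largest index. It is the one peeled off when indicator sums are approximated by induction. *)
Lemma separated_max (K : topologicalType) (I : eqType) (O : I -> set K)
    (i : I) (s : seq I) :
  (forall j k, j != k -> clopen_separated (O j) (O k) \/ clopen_separated (O k) (O j)) ->
  exists2 m, m \in i :: s & forall j, j \in i :: s -> j != m -> clopen_separated (O j) (O m).
Proof.
move=> sepO; elim: s => [|k s [m ms mmax]].
  by exists i; rewrite ?mem_head// => j; rewrite inE => /eqP ->; rewrite eqxx.
have [->|km] := eqVneq k m.
  exists m => [|j]; first by rewrite !inE eqxx orbT.
  rewrite !inE => jE jm; apply: mmax => //.
  by move: jE; rewrite (negPf jm) /= inE.
have [kltm|mltk] := sepO _ _ km.
  exists m => [|j]; first by move: ms; rewrite !inE => /orP[->//|->]; rewrite !orbT.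
  rewrite !inE orbCA => /orP[/eqP->//|jis jm].
  by apply: mmax => //; rewrite inE.
exists k => [|j]; first by rewrite !inE eqxx orbT.
rewrite !inE orbCA => /orP[/eqP->|jis jk]; first by rewrite eqxx.
have [->//|jm] := eqVneq j m.
have [] := mmax j _ jm; first by rewrite inE.
move=> U [cU jU Um]; exists U; split=> //; apply: (subset_trans Um).
by have [V [_ mV Vk]] := mltk; exact: (subset_trans mV).
Qed.

Lemma clopen_between (K : topologicalType) (I : eqType) (O : I -> set K)
    (s : seq I) (B : set K) :
  (forall i, i \in s -> clopen_separated (O i) B) ->
  exists U, [/\ clopen U, forall i, i \in s -> O i `<=` U & U `<=` B].
Proof.
elim: s => [_|i s IH sepB]; first by exists set0; split=> //; exact: clopen0.
have [|U [cU sU UB]] := IH; first by move=> j js; apply: sepB; rewrite inE js orbT.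
have [V [cV iV VB]] := sepB i (mem_head _ _).
exists (V `|` U); split; first exact: clopenU.
  move=> j; rewrite inE => /orP[/eqP->|/sU jU] x Ox; first by left; exact: iV.
  by right; exact: jU.
by move=> x [/VB|/UB].
Qed.

(* Replacing each [O i] by a clopen set lying between it and the next larger
   [O j] changes the sum by at most one summand at each point. *)
Lemma indic_sum_near_continuous (R : realType) (K : topologicalType)
    (I : eqType) (O : I -> set K) (a : I -> R) (M : R) (s : seq I) (U : set K) :
  (forall j k, j != k -> clopen_separated (O j) (O k) \/ clopen_separated (O k) (O j)) ->
  0 <= M -> uniq s -> (forall i, i \in s -> `|a i| <= M) ->
  clopen U -> (forall i, i \in s -> O i `<=` U) ->
  exists h : K -> R, [/\ continuous h,
    forall x, `|\sum_(i <- s) a i * \1_(O i) x - h x| <= M &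
    forall x, ~ U x -> h x = 0].
Proof.
move=> sepO M0; move: {2}(size s) (erefl (size s)) => n.
elim: n s U => [|n IH] s U.
  move=> /size0nil -> _ _ _ _; exists (fun=> 0); split => //.
    by move=> x; exact: cvg_cst.
  by move=> x; rewrite big_nil subr0 normr0.
case: s => // i s ssz us aM cU sU; have [m ms mmax] := separated_max i s sepO.
set t := i :: s in us ms mmax ssz aM sU *.
have tP j : j \in rem m t -> j \in t /\ j != m.
  by rewrite (mem_rem_uniq _ us) !inE => /andP[].
have [V [cV tV Vm]] : exists V, [/\ clopen V,
    forall j, j \in rem m t -> O j `<=` V & V `<=` O m].
  by apply: clopen_between => j /tP[jt jm]; exact: mmax.
have [|||||h [hc hM hV]] := IH (rem m t) V.
- by rewrite size_rem// ssz.
- exact: rem_uniq.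
- by move=> j /tP[/aM].
- by [].
- exact: tV.
(* On [V] the indicators of [O m] and [U] agree, and the inductive bound remains. Off [V] the other
   summands and [h] vanish, which leaves [a m] times a difference of two indicators. *)
exists (fun x => h x + a m * \1_U x); split.
- move=> x; apply: cvgD; first exact: hc.
  by apply: cvgM; [exact: cvg_cst|exact: clopen_indic_continuous].
- move=> x; rewrite (big_rem m)//=.
  have [Vx|nVx] := pselect (V x).
    have Ox := Vm x Vx; have Ux := sU m ms x Ox; rewrite !indicE !mem_set//.
    by rewrite [_ + a m * _]addrC opprD addrACA subrr add0r.
  rewrite hV// add0r big1_seq ?addr0; last first.
    move=> j /andP[_ /tV jV]; rewrite indicE memNset ?mulr0//.
    by move=> /jV.
  rewrite -mulrBr normrM -[leRHS]mulr1 ler_pM// ?aM//.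
  by rewrite !indicE; case: (x \in O m); case: (x \in U);
    rewrite ?subrr ?subr0 ?sub0r ?normrN ?normr0 ?normr1.
- move=> x nUx; rewrite hV ?indicE ?memNset ?mulr0 ?addr0// => /Vm.
  by move/(sU m ms).
Qed.

(** * The twisted sum *)

Section twisted_sum.
Context (R : realType) (K : topologicalType) (cK : compact [set: K]).
Context (I : choiceType) (O : I -> set K).

(* Finite linear combinations of the pairs [(\1_(O i), delta_i)] and [(h, 0)],
   for [h] continuous, as functions on the disjoint union of [K] and [I]. *)
Definition simple (f : K + I -> R) := exists A : set I,
  [/\ finite_set A, forall i, ~ A i -> f (inr i) = 0 &
      continuous (fun x => f (inl x) - \sum_(i \in A) f (inr i) * \1_(O i) x)].

Lemma simple_linear (a : R) (f g : K + I -> R) :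
  simple f -> simple g -> simple (a \*: f + g).
Proof.
move=> [A [fA f0 fc]] [B [fB g0 gc]]; exists (A `|` B); split.
- by rewrite finite_setU.
- by move=> i /not_orP[/f0 fi0 /g0 gi0]; rewrite /= fctE /= fi0 gi0 scaler0 addr0.
- have AE x : \sum_(i \in A) f (inr i) * \1_(O i) x =
              \sum_(i \in A `|` B) f (inr i) * \1_(O i) x.
    apply: fsbig_widen => [|i [_ /f0 /= ->]]; first exact: subsetUl.
    by rewrite mul0r.
  have BE x : \sum_(i \in B) g (inr i) * \1_(O i) x =
              \sum_(i \in A `|` B) g (inr i) * \1_(O i) x.
    apply: fsbig_widen => [|i [_ /g0 /= ->]]; first exact: subsetUr.
    by rewrite mul0r.
  have fAB : finite_set (A `|` B) by rewrite finite_setU.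
  rewrite (_ : (fun x => _) = (fun x =>
    a * (f (inl x) - \sum_(i \in A) f (inr i) * \1_(O i) x) +
    (g (inl x) - \sum_(i \in B) g (inr i) * \1_(O i) x))).
    move=> x; apply: cvgD; last exact: gc.
    by apply: cvgM; [exact: cvg_cst|exact: fc].
  apply/funext => x; rewrite AE BE !fsbig_finite//= mulrBr addrACA -opprD.
  rewrite mulr_sumr -big_split /=; congr (_ - _).
  by apply: eq_bigr => i _; rewrite !fctE /= mulrDl mulrA.
Qed.

Lemma simple_c0 (f : K + I -> R) : simple f -> (f \o inr) \in @c0_pred R I.
Proof.
move=> [A [fA f0 _]]; apply/asboolP => e e0; apply: sub_finite_set fA => i /= ei.
by apply: contrapT => /f0 fi; move: ei; rewrite fi normr0; lra.
Qed.

Lemma simple_bounded (f : K + I -> R) : simple f -> exists M, forall t, `|f t| <= M.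
Proof.
move=> sf; have [N fN] := c0_bounded (simple_c0 sf).
have [A [fA _ fc]] := sf.
have [M fM] := continuous_bounded cK (introT (asboolP _) fc).
exists (Num.max N (M + \sum_(i \in A) `|f (inr i)|)) => -[x|i]; rewrite le_max; last first.
  by rewrite fN.
apply/orP; right; rewrite -[f _](subrK (\sum_(i \in A) f (inr i) * \1_(O i) x)).
rewrite (le_trans (ler_normD _ _))// lerD//.
rewrite !fsbig_finite//=; apply: le_trans (ler_norm_sum _ _ _) _.
apply: ler_sum => i _; rewrite normrM ler_piMr// indicE.
by case: (x \in O i); rewrite ?normr0 ?normr1.
Qed.

Definition twisted_pred : {pred (K + I -> R)} := [pred f | `[< forall e : R,
  0 < e -> exists2 g, simple g & forall t, `|f t - g t| <= e >]].

Lemma simple_twisted (f : K + I -> R) : simple f -> f \in twisted_pred.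
Proof.
move=> sf; apply/asboolP => e e0; exists f => // t.
by rewrite subrr normr0 ltW.
Qed.

Lemma simple_continuous (h : K -> R) : continuous h ->
  simple (fun t => if t is inl x then h x else 0).
Proof.
move=> hc; exists set0; split => //=.
rewrite (_ : (fun x => _) = h)//; apply/funext => x.
by rewrite fsbig_set0 subr0.
Qed.

Lemma twisted_submod : submod_closed twisted_pred.
Proof.
split=> [|a f g /asboolP ft /asboolP gt].
  apply: simple_twisted; rewrite (_ : 0 = fun t => if t is inl x then 0 else 0).
    by apply: simple_continuous => x; exact: cvg_cst.
  by apply/funext => -[].
apply/asboolP => e e0; have a1 : 0 < `|a| + 1 by rewrite ltr_wpDl.
have [|f' sf ff'] := ft (e / 2 / (`|a| + 1)); first by rewrite !divr_gt0.
have [|g' sg gg'] := gt (e / 2); first by rewrite divr_gt0.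
exists (a \*: f' + g'); first exact: simple_linear.
move=> t; rewrite !fctE /= opprD addrACA -scalerBr.
rewrite (le_trans (ler_normD _ _))// [leRHS]splitr lerD//.
rewrite normrM; have := ff' t; rewrite ler_pdivlMr//; apply: le_trans.
by rewrite mulrC ler_wpM2l// lerDl.
Qed.

Lemma twisted_bounded (f : K + I -> R) :
  f \in twisted_pred -> exists M, forall t, `|f t| <= M.
Proof.
move=> /asboolP/(_ 1 ltr01)[g /simple_bounded[M gM] fg]; exists (1 + M) => t.
by rewrite -[f t](subrK (g t)) (le_trans (ler_normD _ _))// lerD.
Qed.

Lemma twisted_uniform_closed (f : K + I -> R) :
  (forall e, 0 < e ->
     exists2 g, g \in twisted_pred & forall t, `|f t - g t| <= e) ->
  f \in twisted_pred.
Proof.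
move=> fu; apply/asboolP => e e0; have e2 : 0 < e / 2 by rewrite divr_gt0.
have [g /asboolP/(_ _ e2)[h sh gh] fg] := fu _ e2; exists h => // t.
by rewrite -(subrKA (g t)) (le_trans (ler_normD _ _))// [leRHS]splitr lerD.
Qed.

Lemma twisted_c0 (f : K + I -> R) : f \in twisted_pred -> (f \o inr) \in @c0_pred R I.
Proof.
move=> /asboolP ft; apply: c0_uniform_closed => e /ft[g sg fg].
by exists (g \o inr); [exact: simple_c0|move=> i; exact: fg].
Qed.

Definition twisted_space :=
  SupSpace twisted_submod twisted_bounded twisted_uniform_closed.

Definition twisted_sum : completeNormedModType R := sup_space_type twisted_space.

Definition inclusion_fun (f : C_space R cK) : twisted_sum :=
  @SupSpaceElt _ _ twisted_space _
    (simple_twisted (simple_continuous (elimT (asboolP _) (valP f)))).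

Lemma inclusion_is_linear : linear inclusion_fun.
Proof.
by move=> a f g; apply: val_inj; apply/funext => -[x|i] //=; rewrite !fctE/= scaler0 addr0.
Qed.

HB.instance Definition _ := GRing.isLinear.Build R (C_space R cK) twisted_sum _
  inclusion_fun inclusion_is_linear.

Definition jump_fun (z : twisted_sum) : c0_space R I :=
  @SupSpaceElt _ _ (SupSpace (@c0_submod R I) (@c0_bounded R I) (@c0_uniform_closed R I)) _
    (twisted_c0 (valP z)).

Lemma jump_is_linear : linear jump_fun.
Proof. by move=> a f g; apply: val_inj; apply/funext => i. Qed.

HB.instance Definition _ := GRing.isLinear.Build R twisted_sum (c0_space R I) _
  jump_fun jump_is_linear.

Definition inclusion : {linear C_space R cK -> twisted_sum} := inclusion_fun.
Definition jump : {linear twisted_sum -> c0_space R I} := jump_fun.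

End twisted_sum.

(** * Exactness of the sequence *)

Section exactness.
Context (R : realType) (K : topologicalType) (cK : compact [set: K]).
Context (I : choiceType) (O : I -> set K).
Context (sepO : forall j k, j != k -> clopen_separated (O j) (O k) \/ clopen_separated (O k) (O j)).
Local Notation Z := (twisted_sum R cK O).
Local Notation inclusion := (@inclusion R K cK I O).
Local Notation jump := (@jump R K cK I O).
Local Notation CK := (C_space R cK).

(** Only the indicator part of [f] has to be approximated; its coefficients are values of [f] on
    [I]. *)
Lemma simple_near_continuous (f : K + I -> R) (M : R) : 0 <= M ->
  simple O f -> (forall i, `|f (inr i)| <= M) ->
  exists2 h : K -> R, continuous h & forall x, `|f (inl x) - h x| <= M.
Proof.
move=> M0 [A [fA f0 fc]] fM.
have [|h [hc hM _]] := @indic_sum_near_continuous R K I O (f \o inr) M (finmap.enum_fset (fset_set A)) setT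
  sepO M0 (finmap.fset_uniq _) (fun i _ => fM i) (@clopenT K).
  by move=> i _ x.
exists (fun x => (f (inl x) - \sum_(i \in A) f (inr i) * \1_(O i) x) + h x).
  by move=> x; apply: cvgD; [exact: fc|exact: hc].
move=> x; have := hM x; rewrite fsbig_finite//=.
set S := (\sum_(i <- _) _); set u := f (inl x); set v := h x.
by rewrite (_ : u - (u - S + v) = S - v)//; ring.
Qed.

Lemma twisted_near_continuous (z : Z) (M e : R) : 0 <= M -> 0 < e ->
  (forall i, `|z (inr i)| <= M) ->
  exists2 h : K -> R, continuous h & forall x, `|z (inl x) - h x| <= M + e.
Proof.
move=> M0 e0 zM; have e2 : 0 < e / 2 by rewrite divr_gt0.
(* Half of [e] pays for replacing [z] by [g], the other half for the larger bound [M + e / 2] on the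
   coefficients of [g]. *)
have /asboolP/(_ _ e2)[g sg zg] := valP z.
have [||h hc hM] := @simple_near_continuous g (M + e / 2) _ sg.
- by rewrite addr_ge0// ltW.
- move=> i; rewrite -[g _](subrK (z (inr i))) (le_trans (ler_normD _ _))//.
  by rewrite addrC lerD// distrC; exact: zg.
exists h => // x; rewrite -(subrKA (g (inl x))) (le_trans (ler_normD _ _))//.
by rewrite [in leRHS](splitr e) addrA addrC lerD//; exact: zg.
Qed.

Lemma inclusion_bounded : bounded_op inclusion.
Proof.
exists 1 => f; rewrite mul1r; apply: sup_norm_le => [|[x|i]]; first exact: normr_ge0.
  exact: (@sup_norm_ub R K _ f x).
by rewrite /= normr0; exact: normr_ge0.
Qed.

Lemma jump_bounded : bounded_op jump.
Proof.
exists 1 => z; rewrite mul1r; apply: sup_norm_le => [|i]; first exact: normr_ge0.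
exact: (@sup_norm_ub R _ _ z (inr i)).
Qed.

Lemma ker_jump : [set z | jump z = 0] = range inclusion.
Proof.
apply/seteqP; split => [z /= z0|_ [f _ <-]]; last first.
  by apply: val_inj; apply/funext.
have zi i : z (inr i) = 0.
  by have := congr1 (fun f : c0_space R I => (f : sup_space_type _) i) z0.
(* With all coefficients zero, the approximation error is arbitrarily small, so the part on [K] is a
   uniform limit of continuous functions. *)
have zc : (fun x => z (inl x)) \in @continuous_pred R K.
  apply: continuous_uniform_closed => e e0.
  have [|h hc zh] := @twisted_near_continuous z 0 e (lexx _) e0.
    by move=> i; rewrite zi normr0.
  by exists h; [exact/asboolP|move=> x; rewrite -[e]add0r].
exists (SupSpaceElt (S := SupSpace (@continuous_submod R K) (@continuous_bounded R K cK)
  (@continuous_uniform_closed R K)) zc) => //.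
by apply: val_inj; apply/funext => -[x|i] //=; rewrite zi.
Qed.

(** Keep the finitely many coefficients above [|a| / 2] in absolute value. Subtracting a nearby
    continuous function from their indicator sum brings the norm of the lift down to at most
    [|a|]. *)
Lemma jump_half_lifting (a : c0_space R I) :
  exists2 z : Z, `|z| <= `|a| & `|a - jump z| <= `|a| / 2.
Proof.
have [->|a0] := eqVneq a 0.
  by exists 0; rewrite ?linear0 ?addr0 ?normr0 ?mul0r.
pose b : sup_space_type _ := a.
have na : 0 < `|a| by rewrite normr_gt0.
have fA : finite_set [set i | `|a| / 2 < `|b i|].
  by have /asboolP := valP b; apply; rewrite divr_gt0.
set A := [set i | _] in fA.
have bM i : `|b i| <= `|a| by exact: sup_norm_ub.
have [|h [hc hM _]] := @indic_sum_near_continuous R K I O b `|a| (finmap.enum_fset (fset_set A)) setT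
  sepO (ltW na) (finmap.fset_uniq _) (fun i _ => bM i) (@clopenT K).
  by move=> i _ x.
pose z (t : K + I) := match t with
  | inl x => \sum_(i \in A) b i * \1_(O i) x - h x
  | inr i => if i \in A then b i else 0 end.
have sz : simple O z.
  exists A; split=> // [i iA|]; first by rewrite /z ifF//; exact: memNset.
  rewrite (_ : (fun x => _) = (fun x => - h x)).
    by move=> x; apply: cvgN; exact: hc.
  apply/funext => x; rewrite (eq_fsbigr (fun i => b i * \1_(O i) x)).
    by rewrite addrC addrA addNr add0r.
  by move=> i iA; rewrite /= iA.
exists (SupSpaceElt (S := twisted_space R cK O) (simple_twisted sz)).
  apply: sup_norm_le => [|[x|i]] /=; first exact: normr_ge0.
    by rewrite fsbig_finite//; exact: hM.
  by case: ifPn; rewrite ?normr0.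
apply: sup_norm_le => [|i] /=; first by rewrite divr_ge0.
rewrite !fctE /=; case: ifPn => [_|/negP iA]; first by rewrite subrr normr0 divr_ge0.
by rewrite subr0 leNgt; apply/negP => bi; apply: iA; exact: mem_set.
Qed.

Lemma twisted_sum_exact : short_exact inclusion jump.
Proof.
split; [exact: inclusion_bounded|exact: jump_bounded| |exact: ker_jump|].
  apply/seteqP; split => [f /= f0|_ ->]; last by rewrite /= linear0.
  apply: val_inj; apply/funext => x.
  by have := congr1 (fun z : Z => (z : sup_space_type _) (inl x)) f0.
exact: surjective_of_half_lifting jump_bounded jump_half_lifting.
Qed.

End exactness.

(** * Unboundedness of projections onto the continuous functions *)

(** This is the boundary of [closure A]. Near a boundary point of [A] itself the complement of [A]
    might have empty interior, whereas here the exterior is an open set to continue in. *)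
Definition two_sided (K : topologicalType) (A : set K) :=
  closure A `&` closure (~` closure A).

Section nontriviality.
Context (R : realType) (K : topologicalType) (cK : compact [set: K]).
Context (I : choiceType) (O : I -> set K).
Context (sepO : forall j k, j != k ->
  clopen_separated (O j) (O k) \/ clopen_separated (O k) (O j)).
Context (openO : forall i, open (O i)).

Context (denseO : forall V, open V -> V !=set0 ->
  exists i, V `&` two_sided (O i) !=set0).
Context (K0 : [set: K] !=set0).
Local Notation Z := (twisted_sum R cK O).
Local Notation inclusion := (@inclusion R K cK I O).
Local Notation CK := (C_space R cK).

Definition generator_fun (i : I) (t : K + I) : R :=
  match t with inl x => \1_(O i) x | inr j => (j == i)%:R end.

Lemma generator_simple i : simple O (generator_fun i).
Proof.
exists [set i]; split=> [|j /eqP/negPf/= -> //|]; first exact: finite_set1.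
rewrite (_ : (fun x => _) = (fun=> 0)); first by move=> x; exact: cvg_cst.
by apply/funext => x; rewrite fsbig_set1 /= eqxx mul1r subrr.
Qed.

Definition generator i : Z :=
  SupSpaceElt (S := twisted_space R cK O) (simple_twisted (generator_simple i)).

(** Such a [z] is within 2 of a continuous [h] (1 for the coefficients, 1 for the slack), and
    subtracting [h] does not change [z - q z], since [q] is a left inverse of [inclusion]. *)
Lemma sub_projection_bounded (q : {linear Z -> CK}) : bounded_op q -> q \o inclusion = id ->
  exists N : R, forall z : Z, (forall i, `|z (inr i)| <= 1) ->
    forall x, z (inl x) - q z x <= N.
Proof.
move=> [M qM] qi; exists (2 + `|M| * 2) => z z1 x.
have [h hc zh] := twisted_near_continuous (cK := cK) sepO ler01 ltr01 z1.
pose f : CK := SupSpaceElt (S := SupSpace (@continuous_submod R K)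
  (@continuous_bounded R K cK) (@continuous_uniform_closed R K)) (introT (asboolP _) hc).
pose d : Z := z - inclusion f.
have nd : `|d| <= 2.
  apply: sup_norm_le => // -[y|i]; first exact: zh.
  by rewrite [d _]subr0 (le_trans (z1 i))// ler1n.
have qd : q d = q z - f.
  by rewrite linearB -[in RHS](congr1 (@^~ f) qi).
have qdx : q d x = q z x - h x by rewrite qd.
have -> : z (inl x) - q z x = d (inl x) - q d x.
  rewrite qdx (_ : d (inl x) = z (inl x) - h x)//; ring.
have d1 : `|d (inl x)| <= `|d| := sup_norm_ub _ _.
have d2 : `|q d x| <= `|q d| := sup_norm_ub _ _.
rewrite (le_trans (ler_norm _))// (le_trans (ler_normB _ _))// lerD//.
  exact: le_trans nd.
apply: le_trans d2 _; apply: le_trans (qM _) _.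
apply: (le_trans (ler_wpM2r (normr_ge0 d) (ler_norm M))).
exact: ler_wpM2l.
Qed.

(** Each step adds one generator with sign and gains 1/3 on a smaller open set. Keeping [V] away
    from the boundaries already used makes every new index fresh, so all coefficients stay in
    [{-1, 0, 1}]. *)
Lemma sub_projection_unbounded (q : {linear Z -> CK}) (n : nat) :
  exists (z : Z) (V : set K), [/\ open V, V !=set0,
    forall i, `|z (inr i)| <= 1,
    forall i, z (inr i) != 0 -> V `&` two_sided (O i) = set0 &
    forall x, V x -> n%:R / 3 <= z (inl x) - q z x].
Proof.
elim: n => [|n [z [V [oV V0 z1 zV Vn]]]].
  exists 0, setT; split => //; first exact: openT.
  - by move=> i; rewrite normr0.
  - by move=> i; rewrite eqxx.
  - by move=> x _; rewrite linear0 mul0r subrr.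
have [i [x [Vx [xO xnO]]]] := denseO oV V0.
have zi : z (inr i) = 0.
  apply/eqP/negPn/negP => /zV VO; suff : set0 x by [].
  by rewrite -VO.
pose u : K -> R := q (generator i).
have uc : continuous u := elimT (asboolP _) (valP (q (generator i))).
have gen1 (s : R) j : `|s| = 1 -> `|(z + s *: generator i) (inr j)| <= 1.
  move=> s1; rewrite /= !fctE /=; have [->|_] := eqVneq j i.
    by rewrite zi add0r scaler1 s1.
  by rewrite scaler0 addr0.
have gen2 (s : R) j : (z + s *: generator i) (inr j) != 0 -> j = i \/ z (inr j) != 0.
  rewrite /= !fctE /=; have [->|_] := eqVneq j i; first by left.
  by rewrite scaler0 addr0; right.
have genE (s : R) y : (z + s *: generator i) (inl y) - q (z + s *: generator i) y =
    z (inl y) - q z y + s * (\1_(O i) y - u y).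
  rewrite linearD linearZ /= !fctE /= -/(u y) /GRing.scale /=; ring.
(* If [u x] is at least 1/2, subtract the generator and pass to the exterior of [O i], where the
   gain is [u > 1/3]. Otherwise add it and pass into [O i], where the gain is [1 - u > 1/3]. *)
have [ux|ux] := leP (1/2) (u x).
- have nux : nbhs x [set y | 1/3 < u y].
    by apply: (cvgr_gt (u x) (uc x)); lra.
  have oU : open ((V `&` u @^-1` [set r | 1/3 < r]) `&` ~` closure (O i)).
    apply: openI; last by rewrite openC; exact: closed_closure.
    by apply: openI => //; apply: open_comp => //; exact: open_gt.
  exists (z + (-1) *: generator i), ((V `&` u @^-1` [set r | 1/3 < r]) `&` ~` closure (O i)).
  split=> //.
  + have [y [yO [Vy uy]]] := xnO _ (filterI (open_nbhs_nbhs (conj oV Vx)) nux).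
    by exists y.
  + by move=> j; apply: gen1; rewrite normrN1.
  + move=> j /gen2[->|/zV VO]; rewrite -subset0 => y [[[Vy _] yO] yj].
      by case: yj.
    by rewrite -VO.
  + move=> y [[Vy /= uy] yO]; rewrite genE (_ : \1_(O i) y = 0); last first.
      by rewrite indicE memNset// => /subset_closure.
    by have := Vn y Vy; rewrite -[n.+1%:R]natr1; lra.
- have nux : nbhs x [set y | u y < 2/3].
    by apply: (cvgr_lt (u x) (uc x)); lra.
  have oU : open ((V `&` u @^-1` [set r | r < 2/3]) `&` O i).
    by apply: openI => //; apply: openI => //; apply: open_comp => //; exact: open_lt.
  exists (z + 1 *: generator i), ((V `&` u @^-1` [set r | r < 2/3]) `&` O i).
  split=> //.
  + have [y [yO [Vy uy]]] := xO _ (filterI (open_nbhs_nbhs (conj oV Vx)) nux).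
    by exists y.
  + by move=> j; apply: gen1; rewrite normr1.
  + move=> j /gen2[->|/zV VO]; rewrite -subset0 => y [[[Vy _] yO] yj].
      have [w [nw Ow]] := yj.2 _ (open_nbhs_nbhs (conj (openO i) yO)).
      by apply: nw; exact: subset_closure.
    by rewrite -VO.
  + move=> y [[Vy /= uy] yO]; rewrite genE (_ : \1_(O i) y = 1); last by rewrite indicE mem_set.
    by have := Vn y Vy; rewrite -[n.+1%:R]natr1; lra.
Qed.

Lemma twisted_sum_nontrivial : ~ trivial_sequence inclusion.
Proof.
move=> [q bq qi]; have [N qN] := sub_projection_bounded bq qi.
(* This number of steps makes [n / 3] exceed [|N|]. *)
have [z [V [_ [x Vx] z1 _ Vn]]] := sub_projection_unbounded q (Num.truncn (3 * `|N|)).+1.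
have := le_trans (Vn x Vx) (qN z z1 x).
have := truncnS_gt (3 * `|N|); have := ler_norm N; lra.
Qed.

End nontriviality.

(** * The remainder of the integers *)

(** The set usually written [A^*]; it depends on [A] only modulo finite sets. *)
Definition star (A : set nat) : set omega_star := [set x | sval (set_val x) A].

Lemma omega_star_ultra (x : omega_star) : UltraFilter (sval (set_val x)).
Proof. exact: proj2_sig (set_val x). Qed.

Lemma omega_star_filter (x : omega_star) : ProperFilter (sval (set_val x)).
Proof. exact: (@ultra_proper _ _ (omega_star_ultra x)). Qed.

Lemma subset_star A B : A `<=` B -> star A `<=` star B.
Proof. by move=> AB x; exact: (@filterS _ _ (omega_star_filter x)). Qed.

Lemma starI A B : star (A `&` B) = star A `&` star B.
Proof.
apply/seteqP; split=> [x xAB|x [xA xB]]; last exact: (@filterI _ _ (omega_star_filter x)).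
by split; apply: subset_star xAB; [exact: subIsetl|exact: subIsetr].
Qed.

Lemma star0 : star set0 = set0.
Proof. by rewrite -subset0 => x /(@filter_ex _ _ (omega_star_filter x))[]. Qed.

Lemma starC A : star (~` A) = ~` star A.
Proof.
apply/seteqP; split=> [x xnA xA|x nxA].
  have : (star A `&` star (~` A)) x by [].
  by rewrite -starI setICr star0.
by have [//|] := in_ultra_setVsetC A (omega_star_ultra x).
Qed.

Lemma starU A B : star (A `|` B) = star A `|` star B.
Proof. by apply: setC_inj; rewrite setCU -!starC setCU starI. Qed.

Lemma star_set1 n : star [set n] = set0.
Proof.
rewrite -subset0 => x xn; have : (~` range (@beta_inj nat)) (set_val x) := set_valP x.
apply; exists n => //; move: xn; rewrite /star /=.
case: (set_val x) => F FU /= Fn; apply: eq_exist.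
apply/esym/(@max_filter _ _ (principal_filter_ultra n)) => A /principal_filterP An.
by apply: filterS Fn => m ->.
Qed.

Lemma star_finite A : finite_set A -> star A = set0.
Proof.
move=> /finite_seqP[s ->]; elim: s => [|n s IH].
  by rewrite (_ : [set` _] = set0) ?star0// -subset0.
rewrite (_ : [set` _] = [set n] `|` [set` s]) ?starU ?star_set1 ?IH ?setU0//.
by apply/seteqP; split => m /=; rewrite inE => /predU1P.
Qed.

Lemma star_unbounded A n : star A !=set0 -> exists2 m, (n <= m)%N & A m.
Proof.
move=> [x xA]; apply: contrapT => An; have : star `I_n x.
  apply: subset_star xA => m Am /=; rewrite ltnNge; apply/negP => nm.
  by apply: An; exists m.
by rewrite star_finite.
Qed.

(** An ultrafilter extending [G] contains the complement of every singleton, hence is not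
    principal. *)
Lemma omega_star_filter_cluster (G : set_system nat) :
  ProperFilter G -> (forall n, G (~` [set n])) ->
  exists x, forall A, G A -> star A x.
Proof.
move=> /ultraFilterLemma[H [HU GH]] Gn.
have Hfree : (~` range (@beta_inj nat)) (exist _ H HU).
  move=> [n _ /(congr1 sval)/= nH].
  have : H [set n] by rewrite -nH; apply/principal_filterP.
  have : H (~` [set n]) by exact: GH.
  move=> Hn' Hn; have := @filterI _ _ (@ultra_proper _ _ HU) _ _ Hn Hn'.
  by rewrite setICr => /filter_ex[].
by exists (SigSub (mem_set Hfree)) => A /GH.
Qed.

Lemma star_neq0 A : (forall n, exists2 m, (n <= m)%N & A m) -> star A !=set0.
Proof.
(* [G] is the filter generated by the tails of [A]. *)
move=> An; pose G : set_system nat := [set S | exists n, forall m, (n <= m)%N -> A m -> S m].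
have GF : ProperFilter G.
  apply: Build_ProperFilter_ex => [S [n nS]|].
    by have [m nm Am] := An n; exists m; exact: nS.
  split; first by exists 0%N.
    move=> S T [n nS] [k kT]; exists (maxn n k) => m; rewrite geq_max => /andP[nm km] Am.
    by split; [exact: nS|exact: kT].
  by move=> S T ST [n nS]; exists n => m nm Am; apply/ST/nS.
have [|x Gx] := @omega_star_filter_cluster G GF.
  by move=> n; exists n.+1 => m nm _ /= mn; move: nm; rewrite mn ltnn.
by exists x; apply: Gx; exists 0%N.
Qed.

Lemma star_base (V : set omega_star) x : open V -> V x ->
  exists2 A, star A x & star A `<=` V.
Proof.
move=> [V' oV' <-] /= V'x.
have [A xA AV'] := beta_nbhs (open_nbhs_nbhs (conj oV' V'x)).
by exists A => // y yA; exact: AV'.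
Qed.

Lemma star_open A : open (star A).
Proof. by exists (beta_basic A) => //; exact: beta_basic_open. Qed.

Lemma star_clopen A : clopen (star A).
Proof. by split; [exact: star_open|rewrite -openC -starC; exact: star_open]. Qed.

(* Otherwise the sets [A], [B] with [star A `<=` G] and [star B `<=` ~` G] never
   cover, and an ultrafilter avoiding all of them lies neither in [G] nor in
   its complement. *)
Lemma clopen_star (G : set omega_star) : clopen G -> exists A, G = star A.
Proof.
move=> [oG cG]; apply: contrapT => nG.
pose H : set_system nat := [set S | exists A B,
  [/\ star A `<=` G, star B `<=` ~` G & ~` (A `|` B) `<=` S]].
have HF : ProperFilter H.
  apply: Build_ProperFilter_ex => [S [A [B [AG BG ABS]]]|].
    apply: contrapT => S0; apply: nG; exists A; apply/seteqP; split => // x Gx.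
    have AB : A `|` B = setT.
      apply/seteqP; split => // n _; apply: contrapT => nAB.
      by apply: S0; exists n; exact: ABS.
    have : star (A `|` B) x by rewrite AB; exact: (@filterT _ _ (omega_star_filter x)).
    by rewrite starU => -[//|/BG].
  split.
  - by exists set0, set0; rewrite star0; split.
  - move=> S T [A [B [AG BG ABS]]] [C [D [CG DG CDT]]].
    exists (A `|` C), (B `|` D); rewrite !starU; split.
    + by move=> x [/AG|/CG].
    + by move=> x [/BG|/DG].
    + move=> n /not_orP[/not_orP[nA nC] /not_orP[nB nD]]; split.
        by apply: ABS => -[].
      by apply: CDT => -[].
  - move=> S T ST [A [B [AG BG ABS]]]; exists A, B; split => //.
    exact: subset_trans ST.
have [|x Hx] := @omega_star_filter_cluster H HF.
  by move=> n; exists [set n], set0; rewrite star_set1 star0 setU0; split.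
(* On whichever side of [G] the point [x] lies, it has a basic neighbourhood [star A] on that side,
   and then the complement of [A] is in [H]. *)
suff [A [xA]] : exists A, star A x /\ H (~` A) by move/Hx; rewrite starC.
have [Gx|nGx] := pselect (G x).
  have [A xA AG] := star_base oG Gx; exists A; split => //.
  by exists A, set0; rewrite star0 setU0; split.
have oG' : open (~` G) by rewrite openC.
have [A xA AG] := star_base oG' nGx; exists A; split => //.
by exists set0, A; rewrite star0 set0U; split.
Qed.

(** A diagonal argument: choose [c n >= n] in the first [n + 1] representing sets. The range of [c]
    is infinite and lies in each [C n] up to the finitely many values [c k] with [k < n]. *)
Lemma clopen_decreasing_bigcap (G : nat -> set omega_star) :
  (forall n, clopen (G n)) -> (forall n, G n !=set0) ->
  (forall n, G n.+1 `<=` G n) ->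
  exists V, [/\ open V, V !=set0 & forall n, V `<=` G n].
Proof.
move=> Gc G0 Gdec; have /choice[C CE] := fun n => clopen_star (Gc n).
pose D n := [set m | forall k, (k <= n)%N -> C k m].
have GD n : G n `<=` star (D n).
  elim: n => [|n IH] x Gx.
    move: Gx; rewrite CE; apply: subset_star => m Cm k.
    by rewrite leqn0 => /eqP ->.
  have : star (D n `&` C n.+1) x.
    by rewrite starI -CE; split=> //; exact/IH/Gdec.
  apply: subset_star => m [Dm Cm] k; rewrite leq_eqVlt => /predU1P[->//|].
  by rewrite ltnS; exact: Dm.
have /choice[c cP] n : exists m, (n <= m)%N /\ D n m.
  by have [|m nm Dm] := @star_unbounded (D n) n; [have [x /GD] := G0 n; exists x|exists m].
exists (star (range c)); split; first exact: star_open.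
  by apply: star_neq0 => n; exists (c n) => //; have [] := cP n.
move=> n x xc; rewrite CE; apply: contrapT => nxC; have xC : star (~` C n) x by rewrite starC.
have : star (c @` `I_n) x.
  have : star (range c `&` ~` C n) x by rewrite starI.
  apply: subset_star => _ [[k _ <-] nCk]; exists k => //=.
  by rewrite ltnNge; apply/negP => nk; apply: nCk; have [_] := cP k; exact.
by rewrite star_finite//; exact: finite_image.
Qed.

(** * Unions of sequences from a splitting chain *)

Section clopen_chain.
Context (F : set (set omega_star)) (splitF : splitting_chain F).
Context (clopenF : forall U, F U -> clopen U).

Lemma chain_total U V : F U -> F V -> U `<=` V \/ V `<=` U.
Proof.
move=> FU FV; have [[|->]|[|->]] := splitF.1.2 U V FU FV.
- by move=> UV; left; exact: subset_trans (@subset_closure _ _) UV.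
- by left.
- by move=> VU; right; exact: subset_trans (@subset_closure _ _) VU.
- by left.
Qed.

Lemma chain_strictly_increasing V : clopen V -> V !=set0 ->
  exists u : nat -> set omega_star, forall n,
    [/\ F (u n), u n `<=` u n.+1 & (V `&` u n.+1) `\` u n !=set0].
Proof.
move=> [oV _] V0.
(* A member splitting the part of [V] outside [U] cannot lie inside [U], so it contains [U]; it
   still leaves some of [V] uncovered, so the choice can be iterated. *)
have /choice[next nextP] : forall U, exists U', F U -> V `\` U !=set0 ->
    [/\ F U', U `<=` U', (V `&` U') `\` U !=set0 & V `\` U' !=set0].
  move=> U; have [FU|] := pselect (F U); last by exists U.
  have [VU0|] := pselect (V `\` U !=set0); last by exists U.
  have oVU : open (V `\` U).
    by rewrite setDE; apply: openI => //; rewrite openC; case: (clopenF FU).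
  have [U' FU' [[x [[Vx nUx] U'x]] [y [[Vy nUy] nU'y]]]] := splitF.2 _ oVU VU0.
  exists U' => _ _; split=> //; [|by exists x|by exists y].
  by have [//|U'U] := chain_total FU FU'; have := U'U _ U'x.
have [U FU [_ VU0]] := splitF.2 _ oV V0.
have FV n : F (iter n next U) /\ V `\` iter n next U !=set0.
  by elim: n => [//|n [Fn Vn]] /=; have [] := nextP _ Fn Vn.
exists (fun n => iter n next U) => n; have [Fn Vn] := FV n.
by have [] := nextP _ Fn Vn.
Qed.

Definition chain_limit (A : set omega_star) :=
  A = set0 \/ exists2 u : nat -> set omega_star, (forall n, F (u n)) & A = \bigcup_n u n.

Lemma chain_limit_open A : chain_limit A -> open A.
Proof.
move=> [->|[u Fu ->]]; first exact: open0.
by apply: bigcup_open => n _; case: (clopenF (Fu n)).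
Qed.

(** If [t n] contains a point outside the union of the [s k], it is contained in no [s k], hence
    contains them all and is the separating clopen set. *)
Lemma chain_limit_separated A B : chain_limit A -> chain_limit B -> A <> B ->
  clopen_separated A B \/ clopen_separated B A.
Proof.
have sep0 C : clopen_separated set0 C by exists set0; split=> //; exact: clopen0.
move=> [->|[u Fu ->]]; first by left.
move=> [->|[v Fv ->]] AB; first by right.
have sep (s t : nat -> set omega_star) : (forall n, F (s n)) -> (forall n, F (t n)) ->
    ~ \bigcup_n t n `<=` \bigcup_n s n ->
    clopen_separated (\bigcup_n s n) (\bigcup_n t n).
  move=> Fs Ft /existsNP[x /not_implyP[[n _ tx] sx]].
  exists (t n); split; [exact: clopenF| |by move=> y ty; exists n].
  move=> y [k _ sy]; have [/(_ y)|tsk] := chain_total (Fs k) (Ft n); first exact.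
  by case: sx; exists k => //; exact: tsk.
have [BA|nBA] := pselect (\bigcup_n v n `<=` \bigcup_n u n); last by left; exact: sep.
right; apply: sep => // AB'; apply: AB; exact/seteqP.
Qed.

Lemma chain_limit_two_sided V : clopen V -> V !=set0 ->
  exists2 A, chain_limit A & V `&` two_sided A !=set0.
Proof.
move=> cV V0; have [u uP] := chain_strictly_increasing cV V0.
have Fu n : F (u n) by have [] := uP n.
pose A := \bigcup_n u n; exists A; first by right; exists u.
apply: contrapT => /set0P/negP/negPn/eqP VA.
(* Without two-sided points in [V], the closure of [A] is relatively open in [V]. *)
have WE : V `&` closure A = V `\` closure (~` closure A).
  apply/seteqP; split=> x [Vx Ax]; split=> //.
    by move=> nAx; suff : set0 x by []; rewrite -VA.
  by apply: contrapT => nAx; apply: Ax; exact: subset_closure.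
have cW : clopen (V `&` closure A).
  split.
    rewrite WE setDE; apply: openI; first exact: cV.1.
    by rewrite openC; exact: closed_closure.
  by apply: closedI; [exact: cV.2|exact: closed_closure].
have [|n|n|E [oE E0 EW]] := @clopen_decreasing_bigcap (fun n => (V `&` closure A) `\` u n).
- by move=> n; rewrite setDE; apply: clopenI => //; apply: clopenC => //; exact: clopenF.
- have [_ _ [x [[Vx ux] nux]]] := uP n; exists x; split=> //; split=> //.
  by apply: subset_closure; exists n.+1.
- have [_ uu _] := uP n; move=> x [Wx nux]; split=> //; by move/uu.
(* The open set [E] lies in the closure of [A] but misses every [u n], which is absurd. *)
have [x Ex] := E0; have [[Vx Ax] _] := EW 0%N x Ex.
have [y [[n _ uy] Ey]] := Ax E (open_nbhs_nbhs (conj oE Ex)).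
by have [_] := EW n y Ey.
Qed.

(** An index is read as a subset of [nat], so the indices run over all basic sets [star A], and
    every nonempty open set contains a nonempty one. *)
Lemma chain_limit_family : exists O : continuum -> set omega_star,
  [/\ forall i, chain_limit (O i),
      forall i j, i != j -> clopen_separated (O i) (O j) \/ clopen_separated (O j) (O i) &
      forall V, open V -> V !=set0 -> exists i, V `&` two_sided (O i) !=set0].
Proof.
have /choice[B BP] : forall i : continuum, exists A, chain_limit A /\
    (star [set n | i n] !=set0 -> star [set n | i n] `&` two_sided A !=set0).
  move=> i; have [V0|] := pselect (star [set n | i n] !=set0); last first.
    by exists set0; split => //; left.
  by have [A lA VA] := chain_limit_two_sided (star_clopen _) V0; exists A.
(* [O i] is [B i] if [i] is the chosen index of [B i], so no nonempty set is
   repeated. *)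
pose rep A := xget point [set i : continuum | B i = A].
pose O i := if rep (B i) == i then B i else set0.
have lO i : chain_limit (O i).
  by rewrite /O; case: ifP => _; [exact: (BP i).1|left].
exists O; split=> // [i j ij|V oV [x Vx]].
  (* A nonempty value determines its index through [rep], so equal values at distinct indices are
     empty. *)
  have [OE|] := pselect (O i = O j); last exact: chain_limit_separated.
  left; suff -> : O i = set0 by exists set0; split => //; exact: clopen0.
  apply: contrapT => Oi0; case/eqP: ij.
  have Bi : rep (B i) = i /\ O i = B i.
    by move: Oi0; rewrite /O; case: ifP => // /eqP.
  have Bj : rep (B j) = j /\ O j = B j.
    by move: Oi0; rewrite OE /O; case: ifP => // /eqP.
  by rewrite -Bi.1 -Bj.1 -Bi.2 -Bj.2 OE.
have [A xA AV] := star_base oV Vx.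
pose i : continuum := fun n => `[< A n >].
have iA : star [set n | i n] = star A.
  by congr star; apply/seteqP; split => n /asboolP.
have [|y [iy yB]] := (BP i).2; first by rewrite iA; exists x.
(* The set found for [i] may have been erased at [i], but it survives at its representative
   index. *)
have Bj : B (rep (B i)) = B i by apply: (@xgetPex _ point [set j | B j = B i]); exists i.
exists (rep (B i)), y; split; first by apply: AV; rewrite -iA.
by rewrite /O Bj eqxx.
Qed.

End clopen_chain.

(** * The twisted sum over [omega_star] *)

Theorem theorem3p7 (R : realType) :
  (exists F : set (set omega_star),
     splitting_chain F /\ (forall U, F U -> clopen U)) ->
  exists (Z : completeNormedModType R)
         (i : {linear C_space R omega_star_compact -> Z})
         (p : {linear Z -> c0_space R continuum}),
    short_exact i p /\ ~ trivial_sequence i.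
Proof.
move=> [F [splitF clopenF]].
have [ O [lO sepO denseO]] := chain_limit_family splitF clopenF.
exists (twisted_sum R omega_star_compact O).
exists (inclusion R omega_star_compact O), (jump R omega_star_compact O).
split; first exact: twisted_sum_exact.
apply: twisted_sum_nontrivial => // [i|]; first exact: chain_limit_open (lO i).
have [x _] : star setT !=set0 by apply: star_neq0 => n; exists n.
by exists x.
Qed.
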